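(* Let $\Gamma(t)=(q(t),p(t))$ be a non-degenerate parametrized curve in $M^4$ and $v=\Gamma'(t)$. For small $\epsilon$ put $q=q(t)$, $q_\epsilon=q(t+\epsilon)$, let $\ell$ be the line through $q$ and $q_\epsilon$, and let $\bar q$, $\bar q_\epsilon$ be the intersection points of $\ell$ with the lines $p(t)$, $p(t+\epsilon)$ respectively. Then $$[q,q_\epsilon,\bar q,\bar q_\epsilon]=\tfrac12\epsilon^2\,\mathbf g(v,v)+O(\epsilon^3),$$ where $[\cdot,\cdot,\cdot,\cdot]$ is the cross-ratio and $\mathbf g$ is the dancing metric on $M^4$.
   Context: The cross-ratio of four distinct points $a_1,a_2,a_3,a_4$ on a line $\ell\subset\mathbb{RP}^2$ is $[a_1,a_2,a_3,a_4]:=\frac{x_1-x_3}{x_1-x_4}\cdot\frac{x_4-x_2}{x_3-x_2}$, where $x_i$ is the coordinate of $a_i$ with respect to some affine coordinate $x$ on $\ell$ (the value does not depend on the affine coordinate chosen). $M^4\subset\mathbb{RP}^2\times\mathbb{RP}^{2*}$ is the set of non-incident point–line pairs, i.e. pairs $([\mathbf q],[\mathbf p])$ with $\mathbf q\in\mathbb R^3\setminus 0$ (columns), $\mathbf p\in(\mathbb R^3)^*\setminus 0$ (rows), $\mathbf p\mathbf q\ne0$; $[\mathbf p]$ represents the line $\{[\mathbf q]:\mathbf p\mathbf q=0\}$. A curve $(q(t),p(t))$ is non-degenerate if $q'(t)\ne0$ and $p'(t)\neq0$ for all $t$. Let $Q^5=\{\mathbf p\mathbf q=1\}\subset\mathbb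 R^3\oplus(\mathbb R^3)^*$ carry the restriction of the flat metric $-2\,d\mathbf p\,d\mathbf q$ (where the symmetric product is $(xy)(v,w)=\frac12[x(v)y(w)+y(v)x(w)]$, so a tangent vector $(\dot{\mathbf q},\dot{\mathbf p})$ has squared norm $-2\dot{\mathbf p}\dot{\mathbf q}$). The dancing metric $\mathbf g$ is the unique pseudo-riemannian metric on $M^4$ (signature $(2,2)$) for which $(\mathbf q,\mathbf p)\mapsto([\mathbf q],[\mathbf p])$, $Q^5\to M^4$, is a pseudo-riemannian submersion.
   Formalization: With the given cross-ratio formula the printed left side tends to 1, not 0; what is proved is [q, q̄, q_ε, q̄_ε] = ½ε²g(v,v)+O(ε³) (middle points exchanged) and, in the printed order, [q, q_ε, q̄, q̄_ε] = 1 − ½ε²g(v,v)+O(ε³). *)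

(* Defs.v *)
From HB Require Import structures.
From mathcomp Require Import all_boot all_order all_algebra.
From mathcomp Require Import all_classical all_reals all_analysis.
From mathcomp Require Import ring.

Set Implicit Arguments.
Unset Strict Implicit.
Unset Printing Implicit Defensive.

Import Order.TTheory GRing.Theory Num.Theory.
Import numFieldNormedType.Exports.

Local Open Scope classical_set_scope.
Local Open Scope ring_scope.

(** Projective spaces.  A point of the projectivization of V is a subspace of
    V of dimension 1.  A tangent vector at [<[x]>] is the image of some
    (x, X) in (V minus 0) x V under the differential of x |-> [<[x]>], and is
    encoded as the set of all pairs having that image: two pairs (x, X) and
    (y, Y) have the same image iff y = c x and Y = c X + a x with c != 0. *)

Section Projective.
Variables (R : realType) (m n : nat).
Local Notation V := 'M[R]_(m.+1, n.+1).

Definition dproj (x X : V) : set (V * V) :=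
  [set y | exists c a : R,
     [/\ c != 0, y.1 = c *: x & y.2 = c *: X + a *: x]].

Definition zero_tangent (L : {vspace V}) : set (V * V) := dproj (vpick L) 0.

Definition smooth_on (U : set R) (x : R -> V) : Prop :=
  forall (k : nat) (s : R), U s -> derivable (derive1n k x) s 1.

Definition smooth_lift (U : set R) (L : R -> {vspace V}) (x : R -> V) : Prop :=
  [/\ open U, smooth_on U x & forall s, U s -> x s != 0 /\ L s = <[x s]>%VS].

(* V minus 0 is a principal bundle over the projective space, so that a curve
   is smooth iff it lifts smoothly near each point of its domain. *)
Definition smooth_curve (D : set R) (L : R -> {vspace V}) : Prop :=
  forall t, D t -> exists U x, U t /\ smooth_lift U L x.

(* The set below has a single element when L is smooth near t. *)
Definition velocity (L : R -> {vspace V}) (t : R) : set (V * V) :=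
  xget set0 [set w | exists U x,
    [/\ U t, smooth_lift U L x & w = dproj (x t) (derive1 x t)]].

End Projective.

Section Dancing.
Variable R : realType.
Local Notation V := 'cV[R]_3.
Local Notation W := 'rV[R]_3.

Definition pairing (p : W) (q : V) : R := (p *m q) 0 0.

Definition M4 : set ({vspace V} * {vspace W}) :=
  [set L | exists (q : V) (p : W),
     [/\ pairing p q != 0, L.1 = <[q]>%VS & L.2 = <[p]>%VS]].

Definition smooth_curve_M4 (D : set R) (G : R -> {vspace V} * {vspace W}) :=
  [/\ forall t, D t -> M4 (G t),
      smooth_curve D (fun t => (G t).1) & smooth_curve D (fun t => (G t).2)].

Definition velocity_M4 (G : R -> {vspace V} * {vspace W}) (t : R) :=
  (velocity (fun s => (G s).1) t, velocity (fun s => (G s).2) t).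

Definition nondegenerate_curve (D : set R) (G : R -> {vspace V} * {vspace W}) :=
  forall t, D t ->
    (velocity_M4 G t).1 <> zero_tangent (G t).1 /\
    (velocity_M4 G t).2 <> zero_tangent (G t).2.

Definition Q5 : set (V * W) := [set x | pairing x.2 x.1 = 1].

Definition tangent_Q5 (x : V * W) : set (V * W) :=
  [set X | pairing X.2 x.1 + pairing x.2 X.1 = 0].

(* The polarization of -2 dp dq. *)
Definition flat (X Y : V * W) : R := - (pairing X.2 Y.1 + pairing Y.2 X.1).

(* The differential of (q, p) |-> ([q], [p]) at x. *)
Definition dpi (x X : V * W) : set (V * V) * set (W * W) :=
  (dproj x.1 X.1, dproj x.2 X.2).

Definition vertical (x : V * W) : set (V * W) :=
  [set X | tangent_Q5 x X /\ dpi x X = dpi x 0].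

Definition horizontal (x : V * W) : set (V * W) :=
  [set X | tangent_Q5 x X /\ forall Z, vertical x Z -> flat X Z = 0].

(* A field of nondegenerate symmetric bilinear forms on the tangent spaces of
   M4.  Its smoothness is not required here, as it follows from the condition
   in dancing_metric. *)
Definition metric_M4
    (g : set (V * V) * set (W * W) -> set (V * V) * set (W * W) -> R) : Prop :=
  forall x : V * W, pairing x.2 x.1 != 0 ->
  [/\ forall (a : R) X Y Z, g (dpi x (a *: X + Y)) (dpi x Z) =
                  a * g (dpi x X) (dpi x Z) + g (dpi x Y) (dpi x Z),
      forall X Y, g (dpi x X) (dpi x Y) = g (dpi x Y) (dpi x X)
    & forall X, dpi x X <> dpi x 0 ->
        exists Y, g (dpi x X) (dpi x Y) != 0].

Definition dancing_metric
    (g : set (V * V) * set (W * W) -> set (V * V) * set (W * W) -> R) : Prop :=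
  metric_M4 g /\
  forall x X Y, Q5 x -> horizontal x X -> horizontal x Y ->
    g (dpi x X) (dpi x Y) = flat X Y.

Lemma pairDl p p' (q : V) : pairing (p + p') q = pairing p q + pairing p' q.
Proof. by rewrite /pairing mulmxDl mxE. Qed.

Lemma pairDr (p : W) q q' : pairing p (q + q') = pairing p q + pairing p q'.
Proof. by rewrite /pairing mulmxDr mxE. Qed.

Lemma pairZl a p (q : V) : pairing (a *: p) q = a * pairing p q.
Proof. by rewrite /pairing -scalemxAl mxE. Qed.

Lemma pairZr a (p : W) q : pairing p (a *: q) = a * pairing p q.
Proof. by rewrite /pairing -scalemxAr mxE. Qed.

Lemma pairNl p (q : V) : pairing (- p) q = - pairing p q.
Proof. by rewrite /pairing mulNmx mxE. Qed.

Lemma pairNr (p : W) q : pairing p (- q) = - pairing p q.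
Proof. by rewrite /pairing mulmxN mxE. Qed.

Lemma pair0l (q : V) : pairing 0 q = 0.
Proof. by rewrite /pairing mul0mx mxE. Qed.

Lemma pair0r (p : W) : pairing p 0 = 0.
Proof. by rewrite /pairing mulmx0 mxE. Qed.

Definition pairE := (pairDl, pairDr, pairZl, pairZr, pairNl, pairNr, pair0l, pair0r).

Lemma pair_inj_l (q : V) : (forall p, pairing p q = 0) -> q = 0.
Proof.
move=> h; apply/matrixP => i j; rewrite (ord1 j) [RHS]mxE.
have := h (delta_mx 0 i); rewrite /pairing mxE (bigD1 i) //= big1.
  by rewrite mxE !eqxx mul1r addr0.
by move=> k ki; rewrite mxE (negbTE ki) andbF mul0r.
Qed.

Lemma pair_inj_r (p : W) : (forall q, pairing p q = 0) -> p = 0.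
Proof.
move=> h; apply/matrixP => i j; rewrite (ord1 i) [RHS]mxE.
have := h (delta_mx j 0); rewrite /pairing mxE (bigD1 j) //= big1.
  by rewrite mxE !eqxx mulr1 addr0.
by move=> k ki; rewrite mxE (negbTE ki) mulr0.
Qed.

Definition dancing_formula (x X Y : V * W) : R :=
  - ((pairing X.2 Y.1 + pairing Y.2 X.1) / pairing x.2 x.1
     - (pairing X.2 x.1 * pairing x.2 Y.1 + pairing Y.2 x.1 * pairing x.2 X.1)
       / pairing x.2 x.1 ^+ 2).

Lemma dproj_id m n (x X : 'M[R]_(m.+1, n.+1)) : dproj x X (x, X).
Proof. by exists 1, 0; rewrite /= oner_neq0 !scale1r scale0r addr0. Qed.

Lemma dproj_eq m n (x X : 'M[R]_(m.+1, n.+1)) c a :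
  c != 0 -> dproj (c *: x) (c *: X + a *: x) = dproj x X.
Proof.
move=> c0; apply/seteqP; split=> -[y Y] [d [b [d0 /= -> ->]]].
  exists (d * c), (d * a + b * c); split=> /=; first by rewrite mulf_neq0.
    by rewrite scalerA.
  by rewrite scalerDr !scalerA scalerDl addrA.
exists (d / c), ((b - d / c * a) / c); split=> /=.
- by rewrite mulf_neq0 ?invr_neq0.
- by rewrite scalerA divfK.
rewrite scalerDr !scalerA !divfK// -addrA -scalerDl.
by rewrite [d / c * a + _]addrC subrK.
Qed.

Lemma dpi_eq (x X : V * W) c d a b : c != 0 -> d != 0 ->
  dpi (c *: x.1, d *: x.2) (c *: X.1 + a *: x.1, d *: X.2 + b *: x.2)
  = dpi x X.
Proof. by move=> c0 d0; rewrite /dpi /= !dproj_eq. Qed.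

Lemma dancing_formula_dpi (x X Y y X' Y' : V * W) :
  pairing x.2 x.1 != 0 -> dpi x X = dpi y X' -> dpi x Y = dpi y Y' ->
  dancing_formula y X' Y' = dancing_formula x X Y.
Proof.
move=> px [eX1 eX2] [eY1 eY2].
have x10 : x.1 != 0 by apply: contraNneq px => ->; rewrite pairE.
have x20 : x.2 != 0 by apply: contraNneq px => ->; rewrite pairE.
have : dproj x.1 X.1 (y.1, X'.1) by rewrite eX1; exact: dproj_id.
have : dproj x.1 Y.1 (y.1, Y'.1) by rewrite eY1; exact: dproj_id.
have : dproj x.2 X.2 (y.2, X'.2) by rewrite eX2; exact: dproj_id.
have : dproj x.2 Y.2 (y.2, Y'.2) by rewrite eY2; exact: dproj_id.
move=> [d' [bY [_ /= ed' eY2']]] [d [bX [d0 /= ed eX2']]].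
move=> [c' [aY [_ /= ec' eY1']]] [c [aX [c0 /= ec eX1']]].
have ecc : c = c'.
  have /eqP : (c - c') *: x.1 = 0 by rewrite scalerBl -ec -ec' subrr.
  by rewrite scaler_eq0 (negbTE x10) orbF subr_eq0 => /eqP.
have edd : d = d'.
  have /eqP : (d - d') *: x.2 = 0 by rewrite scalerBl -ed -ed' subrr.
  by rewrite scaler_eq0 (negbTE x20) orbF subr_eq0 => /eqP.
rewrite /dancing_formula ec ed eX1' eX2' eY1' eY2' -ecc -edd !pairE.
by field; rewrite c0 d0 px.
Qed.

Lemma horizontalE (x X : V * W) : Q5 x ->
  horizontal x X <-> pairing X.2 x.1 = 0 /\ pairing x.2 X.1 = 0.
Proof.
rewrite /Q5 /= => xQ; split.
  move=> [tX /(_ (x.1, - x.2))]; rewrite /flat /= => hX.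
  have e : pairing X.2 x.1 + pairing (- x.2) X.1 = 0.
    apply: oppr_inj; rewrite oppr0; apply: hX; split.
      by rewrite /tangent_Q5 /= pairE addNr.
    rewrite -[RHS](@dpi_eq x 0 1 1 1 (-1)) ?oner_neq0//= !scale1r scaleN1r.
    by rewrite !add0r; case: (x).
  move: tX e; rewrite /tangent_Q5 /= pairE => t e.
  have e2 : pairing X.2 x.1 = pairing x.2 X.1 by apply/eqP; rewrite -subr_eq0 e.
  by move: t; rewrite e2 -mulr2n => /eqP; rewrite mulrn_eq0 /= => /eqP.
move=> [h1 h2]; split; first by rewrite /tangent_Q5 /= h1 h2 addr0.
move=> Z [_ [eZ1 eZ2]].
have : dproj x.1 0 (x.1, Z.1) by rewrite -eZ1; exact: dproj_id.
have : dproj x.2 0 (x.2, Z.2) by rewrite -eZ2; exact: dproj_id.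
move=> [d [b [_ _ /= eb]]] [c [a [_ _ /= ea]]].
by rewrite /flat eb ea !scaler0 !add0r !pairE h1 h2 !mulr0 addr0 oppr0.
Qed.

Lemma dancing_metricE g : dancing_metric g ->
  forall x X Y, pairing x.2 x.1 != 0 ->
    g (dpi x X) (dpi x Y) = dancing_formula x X Y.
Proof.
move=> [_ hg] x X Y px; set s := pairing x.2 x.1 in px *.
pose y : V * W := (s^-1 *: x.1, 1 *: x.2).
pose lft (Z : V * W) : V * W :=
  (s^-1 *: Z.1 + (- (pairing x.2 Z.1 / s ^+ 2)) *: x.1,
   1 *: Z.2 + (- (pairing Z.2 x.1 / s)) *: x.2).
have s0 : s^-1 != 0 by rewrite invr_neq0.
have yQ : Q5 y by rewrite /Q5 /y /= !pairE mul1r mulVf.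
have eZ Z : dpi x Z = dpi y (lft Z).
  by rewrite /y /lft dpi_eq ?oner_neq0.
have hZ Z : horizontal y (lft Z).
  apply/(horizontalE _ yQ); rewrite /y /lft /= !pairE -/s.
  by split; field.
rewrite (eZ X) (eZ Y) hg// -(dancing_formula_dpi px (eZ X) (eZ Y)).
have [a1 a2] := (horizontalE (lft X) yQ).1 (hZ X).
have [b1 b2] := (horizontalE (lft Y) yQ).1 (hZ Y).
rewrite /dancing_formula a1 a2 b1 b2 yQ /flat.
by rewrite !mul0r addr0 mul0r subr0 divr1.
Qed.

Lemma dancing_metric_exists : exists g, dancing_metric g.
Proof.
pose g (v w : set (V * V) * set (W * W)) : R := xget 0 [set r | exists x X Y,
  [/\ pairing x.2 x.1 != 0, v = dpi x X, w = dpi x Y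
    & r = dancing_formula x X Y]].
have gE x X Y : pairing x.2 x.1 != 0 ->
    g (dpi x X) (dpi x Y) = dancing_formula x X Y.
  move=> px; rewrite /g; case: xgetP => [r _ [y [X' [Y' [py eX eY ->]]]]|].
    exact: dancing_formula_dpi px eX eY.
  by move/(_ (dancing_formula x X Y)); case; exists x, X, Y.
exists g; split=> [x px|x X Y xQ hX hY]; last first.
  have px : pairing x.2 x.1 != 0 by rewrite xQ oner_neq0.
  have [a1 a2] := (horizontalE X xQ).1 hX.
  have [b1 b2] := (horizontalE Y xQ).1 hY.
  rewrite gE// /dancing_formula a1 a2 b1 b2 xQ /flat.
  by rewrite !mul0r addr0 mul0r subr0 divr1.
split=> [a X Y Z|X Y|X].
- by rewrite !gE// /dancing_formula /= !pairE; field.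
- by rewrite !gE// /dancing_formula; field.
move=> nX; apply: contrapT => hN; apply: nX.
have h0 Y : dancing_formula x X Y = 0.
  by apply: contrapT => /eqP h; apply: hN; exists Y; rewrite gE.
set s := pairing x.2 x.1 in px *.
have e1 : X.1 = (pairing x.2 X.1 / s) *: x.1.
  apply/eqP; rewrite -subr_eq0; apply/eqP/pair_inj_l => p.
  have := h0 (0, p); rewrite /dancing_formula /= !pairE -/s => h.
  apply: (mulfI (invr_neq0 px)); rewrite mulr0 -[RHS]oppr0 -[in RHS]h.
  by field.
have e2 : X.2 = (pairing X.2 x.1 / s) *: x.2.
  apply/eqP; rewrite -subr_eq0; apply/eqP/pair_inj_r => q.
  have := h0 (q, 0); rewrite /dancing_formula /= !pairE -/s => h.
  apply: (mulfI (invr_neq0 px)); rewrite mulr0 -[RHS]oppr0 -[in RHS]h.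
  by field.
rewrite -[RHS](@dpi_eq x 0 1 1 (pairing x.2 X.1 / s) (pairing X.2 x.1 / s))
  ?oner_neq0//= !scale1r !add0r -e1 -e2.
by case: (x); case: (X).
Qed.

Definition line_points (P : {vspace W}) : {vspace V} :=
  lker (linfun (mulmx (vpick P) : V -> 'M[R]_1)).

(* c = (alpha, beta) stands for the coordinate [u] |-> alpha(u) / beta(u),
   with point at infinity beta = 0. *)
Definition coord (c : W * W) (a : {vspace V}) : R :=
  pairing c.1 (vpick a) / pairing c.2 (vpick a).

Definition affine_coord (l : {vspace V}) (c : W * W) : Prop :=
  forall u, u \in l -> pairing c.1 u = 0 -> pairing c.2 u = 0 -> u = 0.

(* The coordinate is chosen on the line through the four points, all of them
   at finite distance; the value does not depend on the coordinate.

   Pitfall on conventions: with this formula the value tends to 1 when a1, a2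
   merge or a3, a4 merge, and it tends to 0 when a1, a3 or a2, a4 merge.
   Exchanging a2 and a3 replaces the value r by 1 - r. *)
Definition cross_ratio (a1 a2 a3 a4 : {vspace V}) : R :=
  let c := xget (0, 0) [set c : W * W |
     affine_coord (a1 + a2 + a3 + a4)%VS c /\
     forall a, a \in [:: a1; a2; a3; a4] -> pairing c.2 (vpick a) != 0] in
  let x1 := coord c a1 in let x2 := coord c a2 in
  let x3 := coord c a3 in let x4 := coord c a4 in
  (x1 - x3) / (x1 - x4) * ((x4 - x2) / (x3 - x2)).

End Dancing.

(* Main.v *)
(** Let x, y be smooth lifts of q, p near t, and put P(a, b) = y(a) x(b).  On the
    line through q and q_e, with homogeneous coordinates relative to x(t) and
    x(s), s = t + e, the two other points are (P(t,s), - P(t,t)) and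
    (P(s,s), - P(s,t)).  Hence
      [q, q_e, qbar, qbar_e] = P(t,t) P(s,s) / (P(s,t) P(t,s)),
    and exchanging the two middle points replaces this value by 1 minus it.
    As P is bilinear in the lifts, expanding x(s), y(s) to second order gives
    1 + e^2 (P y'x' - (y x')(y' x)) / P^2 + O(e^3) with P = P(t,t); the
    coefficient of e^2 is - g(v,v) / 2. *)

Require Import Defs.
From mathcomp Require Import all_boot all_order all_algebra.
From mathcomp Require Import all_classical all_reals all_analysis.
From mathcomp Require Import ring lra.
Import Order.TTheory GRing.Theory Num.Theory.
Import numFieldNormedType.Exports.
Local Open Scope classical_set_scope.
Local Open Scope ring_scope.

(** * Cross-ratios of collinear points in homogeneous coordinates *)

Section CrossRatio.
Set Implicit Arguments.
Unset Strict Implicit.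
Unset Printing Implicit Defensive.

Lemma vpick_line (K : fieldType) (vT : vectType K) (u : vT) :
  u != 0 -> exists2 k : K, k != 0 & vpick <[u]> = k *: u.
Proof.
move=> u0; have /vlineP[k e] := memv_pick <[u]>%VS.
exists k => //; apply: contraNneq u0 => k0.
by rewrite -memv0 -[0%VS]/(0%VS : {vspace vT}) -(eqP (_ : <[u]>%VS == 0%VS)) ?memv_line// -vpick0 e k0 scale0r.
Qed.

Context {R : realType}.
Local Notation V := 'cV[R]_3.
Local Notation W := 'rV[R]_3.

(** The difference of the affine coordinates of [u] and [w] is [det2 c u w] over the product of the
    two values of [c.2]. These products cancel in a cross-ratio, which leaves determinants only. *)
Definition det2 (c : W * W) (u w : V) : R :=
  pairing c.1 u * pairing c.2 w - pairing c.1 w * pairing c.2 u.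

Lemma det2_neq0l c (u w : V) : det2 c u w != 0 -> u != 0.
Proof. by apply: contraNneq => ->; rewrite /det2 !pairE !(mul0r, mulr0) subr0. Qed.

Lemma det2_neq0r c (u w : V) : det2 c u w != 0 -> w != 0.
Proof. by apply: contraNneq => ->; rewrite /det2 !pairE !(mul0r, mulr0) subr0. Qed.

(** This serves to move the point at infinity away from finitely many given points. Each [u] forbids
    at most one value of [k], namely [- r u], and [k] is taken above all of these. *)
Lemma finite_coord (c : W * W) (s : seq V) :
  (forall u, u \in s -> pairing c.1 u != 0 \/ pairing c.2 u != 0) ->
  exists k : R, forall u, u \in s -> pairing (c.1 + k *: c.2) u != 0.
Proof.
move=> hs; pose r (u : V) := pairing c.1 u / pairing c.2 u.
exists (1 + \sum_(u <- s) `|r u|) => u us; rewrite pairE pairE.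
have [c0|c0] := eqVneq (pairing c.2 u) 0.
  by rewrite c0 mulr0 addr0; case: (hs _ us) => //; rewrite c0 eqxx.
have -> : pairing c.1 u = r u * pairing c.2 u by rewrite /r divfK.
rewrite -mulrDl mulf_neq0// gt_eqF//.
have : - r u <= \sum_(u <- s) `|r u|.
  rewrite (big_rem u us)/= (le_trans (ler_norm _))// normrN lerDl.
  exact: sumr_ge0.
lra.
Qed.

(* On the line, det2 of any two coordinates differ by a constant factor (cramer),
   which cancels in the cross-ratio; this makes the choice of coordinate in
   cross_ratio irrelevant. *)
Lemma cross_ratioE (c : W * W) (u1 u2 u3 u4 : V) :
  affine_coord (<[u1]> + <[u2]> + <[u3]> + <[u4]>)%VS c ->
  det2 c u1 u4 != 0 -> det2 c u3 u2 != 0 ->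
  cross_ratio <[u1]> <[u2]> <[u3]> <[u4]> =
  det2 c u1 u3 * det2 c u4 u2 / (det2 c u1 u4 * det2 c u3 u2).
Proof.
move=> hc d14 d32; set l := (_ + _ + _ + _)%VS in hc.
have u10 := det2_neq0l d14; have u40 := det2_neq0r d14.
have u30 := det2_neq0l d32; have u20 := det2_neq0r d32.
have l1 : u1 \in l.
  by rewrite memvE /l -!addvA addvSl.
have l2 : u2 \in l.
  by rewrite memvE /l [(<[u1]> + _)%VS]addvC -!addvA addvSl.
have l3 : u3 \in l.
  by rewrite memvE (subv_trans _ (addvSl _ _))// addvSr.
have l4 : u4 \in l by rewrite memvE addvSr.
(* Only 0 in [l] is killed by both forms of [c], so it suffices that the two sides have the same
   values under [c.1] and [c.2]. *)
have cramer u : u \in l -> u = (det2 c u1 u4)^-1 *: (det2 c u u4 *: u1 - det2 c u u1 *: u4).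
  move=> ul; apply/eqP; rewrite -subr_eq0; apply/eqP; apply: hc.
  - by rewrite !(rpredB, rpredZ).
  - by rewrite !pairE /det2; field.
  - by rewrite !pairE /det2; field.
have detE b u w : u \in l -> w \in l ->
    det2 b u w = det2 c u w * (det2 b u1 u4 / det2 c u1 u4).
  move=> /cramer -> /cramer ->; rewrite /det2 !pairE; move: d14; rewrite /det2 => d14.
  by field.
rewrite /cross_ratio; set S := [set c0 | _].
(* The set must be inhabited, or [xget] would return the default [(0, 0)]. The forms of [c] are
   swapped and the new denominator is adjusted so that the four points are at finite distance. *)
have [b Sb] : exists b, S b.
  have hk u : u \in [:: u1; u2; u3; u4] -> u \in l /\ u != 0.
    by rewrite !inE => /or4P[] /eqP ->.
  have [|k hk'] := @finite_coord c [:: u1; u2; u3; u4].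
    move=> u /hk[ul u0]; have [c1|] := eqVneq (pairing c.1 u) 0; last by left.
    right; apply: contraNneq u0 => c2; exact/eqP/hc.
  exists (c.2, c.1 + k *: c.2); split=> /=.
    move=> u ul; rewrite !pairE => e2; rewrite e2 mulr0 addr0 => e1; exact: hc.
  have hv u : u \in [:: u1; u2; u3; u4] -> pairing (c.1 + k *: c.2) (vpick <[u]>%VS) != 0.
    move=> us; have [_ /vpick_line[m m0 ->]] := hk u us.
    by rewrite pairZr mulf_neq0// hk'.
  by move=> a; rewrite !inE => /or4P[] /eqP ->; apply: hv; rewrite !inE eqxx ?orbT.
have [bl bfin] := xgetI ((0, 0) : W * W) Sb.
move: (xget _ _) bl bfin => {b Sb}b bl bfin.
have hb u : u \in [:: u1; u2; u3; u4] -> u != 0 ->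
    pairing b.2 u != 0 /\ Defs.coord b <[u]>%VS = pairing b.1 u / pairing b.2 u.
  move=> us u0; have [m m0 e] := vpick_line u0.
  have : pairing b.2 (vpick <[u]>%VS) != 0.
    by apply: bfin; move: us; rewrite !inE => /or4P[] /eqP ->; rewrite eqxx ?orbT.
  rewrite e pairZr mulf_eq0 negb_or => /andP[_ h]; split=> //.
  by rewrite /Defs.coord e !pairZr; field; rewrite h m0.
have [b1 ->] := hb u1 ltac:(by rewrite !inE eqxx) u10.
have [b2 ->] := hb u2 ltac:(by rewrite !inE eqxx ?orbT) u20.
have [b3 ->] := hb u3 ltac:(by rewrite !inE eqxx ?orbT) u30.
have [b4 ->] := hb u4 ltac:(by rewrite !inE eqxx ?orbT) u40.
(* The factor brought out by [detE] has to be nonzero in order to cancel. Otherwise the combination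
   [h] below would be killed by both forms of [b], hence vanish, although [u1] and [u4] are
   independent by [d14]. *)
have D0 : det2 b u1 u4 != 0.
  apply: contraNneq u10 => D0.
  have h : pairing b.2 u4 *: u1 - pairing b.2 u1 *: u4 = 0.
    apply: bl; rewrite ?(rpredB, rpredZ)// !pairE; last by ring.
    by rewrite -[RHS]D0 /det2; ring.
  have : det2 c (pairing b.2 u4 *: u1 - pairing b.2 u1 *: u4) u4 = 0.
    by rewrite h /det2 !pairE; ring.
  rewrite (_ : det2 _ _ _ = pairing b.2 u4 * det2 c u1 u4); last first.
    by rewrite /det2 !pairE; ring.
  by move/eqP; rewrite mulf_eq0 (negbTE b4) (negbTE d14).
have dE u w : pairing b.2 u != 0 -> pairing b.2 w != 0 ->
  pairing b.1 u / pairing b.2 u - pairing b.1 w / pairing b.2 w =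
  det2 b u w / (pairing b.2 u * pairing b.2 w).
  by move=> h1 h2; rewrite /det2; field; rewrite h1 h2.
rewrite !dE//.
rewrite !(detE b u1 u3, detE b u4 u2, detE b u3 u2)//.
by field; rewrite d14 d32 D0 b1 b2 b3 b4.
Qed.

Lemma line_pointsE (p : W) (u : V) : p != 0 ->
  (u \in line_points <[p]>) = (pairing p u == 0).
Proof.
move=> p0; have [k k0 e] := vpick_line p0.
rewrite /line_points memv_ker lfunE /= e -scalemxAl scaler_eq0 (negbTE k0) /=.
apply/eqP/eqP => [h|h]; first by rewrite /pairing h mxE.
by apply/matrixP => i j; rewrite !ord1 [RHS]mxE.
Qed.

(** The combination on the right is built to be killed by [p]. Conversely, as [p] does not kill [u],
    the coefficient of [u] in a vector of the kernel is determined by that of [w]. *)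
Lemma line_meet (p : W) (u w : V) : pairing p u != 0 ->
  ((<[u]> + <[w]>) :&: line_points <[p]>)%VS =
  <[pairing p w *: u - pairing p u *: w]>%VS.
Proof.
move=> pu; have p0 : p != 0 by apply: contraNneq pu => ->; rewrite pairE.
apply/vspaceP => z; rewrite memv_cap line_pointsE//; apply/andP/idP.
  move=> [/memv_addP[_ /vlineP[a ->] [_ /vlineP[b ->] ->]]].
  rewrite !pairE => /eqP h; apply/vlineP; exists (- (b / pairing p u)).
  have -> : a = - (b * pairing p w) / pairing p u.
    by apply: (mulIf pu); rewrite divfK//; apply/eqP; rewrite -addr_eq0; apply/eqP.
  by rewrite scalerBr !scalerA -scaleNr; congr (_ *: _ + _ *: _); field.
move=> /vlineP[k ->]; split; last by rewrite !pairE; apply/eqP; ring.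
by rewrite rpredZ// -scaleNr memv_add// rpredZ// memv_line.
Qed.

(** Any form minus a suitable multiple of [p] kills [u], and its value at [w] is then that of the
    original form at [w] minus its projection to [u] along the kernel of [p]. This vector is
    nonzero, so some form detects it. *)
Lemma exists_annihilator (p : W) (u w : V) : pairing p u != 0 ->
  (forall k, w <> k *: u) -> exists2 h : W, pairing h u = 0 & pairing h w != 0.
Proof.
move=> pu hw; apply: contrapT => nh; apply: (hw (pairing p w / pairing p u)).
apply/eqP; rewrite -subr_eq0; apply/eqP/pair_inj_l => h.
apply: contrapT => /eqP hz; apply: nh.
exists (h - (pairing h u / pairing p u) *: p); first by rewrite !pairE; field.
by move: hz; apply: contra_neq; rewrite !pairE => <-; field.
Qed.

(** When [h] kills [u], every determinant relative to [(p, h)] is [pairing p u * pairing h w] times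
    the determinant of the coefficients on [u] and [w]. This factor cancels, so the auxiliary [h]
    leaves no trace in the values. *)
Lemma cross_ratio_chord (p r : W) (u w : V) :
  pairing p u != 0 -> pairing p w != 0 -> pairing r u != 0 ->
  (forall k, w <> k *: u) ->
  let qb := ((<[u]> + <[w]>) :&: line_points <[p]>)%VS in
  let qb_ := ((<[u]> + <[w]>) :&: line_points <[r]>)%VS in
  let P := pairing p u * pairing r w / (pairing p w * pairing r u) in
  cross_ratio <[u]> qb <[w]> qb_ = 1 - P /\ cross_ratio <[u]> <[w]> qb qb_ = P.
Proof.
move=> pu pw ru hw; have [h hu hw0] := exists_annihilator pu hw.
rewrite /= !line_meet//.
have hc : affine_coord (<[u]> + <[w]>)%VS (p, h).
  move=> _ /memv_addP[_ /vlineP[a ->] [_ /vlineP[b ->] ->]] /=.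
  rewrite !pairE hu mulr0 add0r => pz /eqP.
  rewrite mulf_eq0 (negbTE hw0) orbF => /eqP b0.
  move: pz; rewrite b0 mul0r addr0 => /eqP.
  by rewrite mulf_eq0 (negbTE pu) orbF => /eqP ->; rewrite !scale0r addr0.
have sub a b : (<[a *: u - b *: w]> <= <[u]> + <[w]>)%VS.
  by rewrite -memvE -scaleNr memv_add// rpredZ// memv_line.
have hsub (l : {vspace V}) : (l <= <[u]> + <[w]>)%VS -> affine_coord l (p, h).
  by move=> /subvP hl z zl; exact/hc/hl.
have lu : (<[u]> <= <[u]> + <[w]>)%VS := addvSl _ _.
have lw : (<[w]> <= <[u]> + <[w]>)%VS := addvSr _ _.
have uw : det2 (p, h) u w = pairing p u * pairing h w.
  by rewrite /det2 /= hu mulr0 subr0.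
have wu : det2 (p, h) w u = - (pairing p u * pairing h w).
  by rewrite /det2 /= hu mulr0 sub0r.
have uE a b : det2 (p, h) u (a *: u - b *: w) = - (b * (pairing p u * pairing h w)).
  by rewrite /det2 /= !pairE hu; ring.
have wE a b : det2 (p, h) w (a *: u - b *: w) = - (a * (pairing p u * pairing h w)).
  by rewrite /det2 /= !pairE hu; ring.
have Ew a b : det2 (p, h) (a *: u - b *: w) w = a * (pairing p u * pairing h w).
  by rewrite /det2 /= !pairE hu; ring.
have EE a b a' b' : det2 (p, h) (a *: u - b *: w) (a' *: u - b' *: w) =
    pairing p u * pairing h w * (a' * b - a * b').
  by rewrite /det2 /= !pairE hu; ring.
have n0 : pairing p u * pairing h w != 0 by rewrite mulf_neq0.
split; rewrite (@cross_ratioE (p, h)) ?(uw, wu, uE, wE, Ew, EE) ?oppr_eq0 ?mulf_neq0 //;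
  try (by apply: hsub; rewrite !subv_add lu lw !sub);
  by field; rewrite pu pw ru hw0.
Qed.

End CrossRatio.

(** * Bounded functions near 0 and second-order Taylor remainders *)

Section BoundedNearZero.
Context {R : realType}.
Set Implicit Arguments.
Unset Strict Implicit.
Unset Printing Implicit Defensive.

(** This is O(1) at 0, with 0 itself excluded; an error O(e^n) is expressed by applying it to the
    error divided by [e ^+ n]. *)
Definition bounded_near0 (f : R -> R) : Prop :=
  exists K, \forall e \near (0 : R)^', `|f e| <= K.

Lemma near0_shift (A : set R) t :
  open A -> A t -> \forall e \near (0 : R)^', A (t + e).
Proof.
move=> oA At; have [d /= d0 hd] : nbhs t A by exact: open_nbhs_nbhs.
near=> e; apply: hd; rewrite /= opprD addNKr normrN.
by near: e; exact: dnbhs0_lt.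
Unshelve. all: by end_near. Qed.

Lemma bounded_near0_cst a : bounded_near0 (fun=> a).
Proof. by exists `|a|; near=> e. Unshelve. all: by end_near. Qed.

Lemma bounded_near0_id : bounded_near0 id.
Proof.
exists 1; near=> e; apply: ltW; near: e.
exact: dnbhs0_lt.
Unshelve. all: by end_near. Qed.

Lemma bounded_near0D f g :
  bounded_near0 f -> bounded_near0 g -> bounded_near0 (fun e => f e + g e).
Proof.
move=> [K fK] [L gL]; exists (K + L); near=> e.
by rewrite (le_trans (ler_normD _ _))// lerD//; near: e.
Unshelve. all: by end_near. Qed.

Lemma bounded_near0M f g :
  bounded_near0 f -> bounded_near0 g -> bounded_near0 (fun e => f e * g e).
Proof.
move=> [K fK] [L gL]; exists (K * L); near=> e.
by rewrite normrM ler_pM//; near: e.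
Unshelve. all: by end_near. Qed.

Lemma bounded_near0N f : bounded_near0 f -> bounded_near0 (fun e => - f e).
Proof. by move=> [K fK]; exists K; under eq_near do rewrite normrN. Qed.

Lemma bounded_near0_sum (I : Type) (r : seq I) (f : I -> R -> R) :
  (forall i, bounded_near0 (f i)) -> bounded_near0 (fun e => \sum_(i <- r) f i e).
Proof.
move=> hf; elim: r => [|i r IH].
  by under eq_fun do rewrite big_nil; exact: bounded_near0_cst.
by under eq_fun do rewrite big_cons; exact: bounded_near0D.
Qed.

Lemma bounded_near0_pairing (p : R -> 'rV[R]_3) (q : R -> 'cV[R]_3) :
  (forall j, bounded_near0 (fun e => p e 0 j)) ->
  (forall i, bounded_near0 (fun e => q e i 0)) ->
  bounded_near0 (fun e => pairing (p e) (q e)).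
Proof.
move=> hp hq; under eq_fun do rewrite /pairing mxE.
by apply: bounded_near0_sum => i; exact: bounded_near0M.
Qed.

(** The perturbation [e * f e] tends to 0, so it eventually takes away at most half of [|a|]. This
    keeps denominators away from 0. *)
Lemma bounded_near0_perturb a f : a != 0 -> bounded_near0 f ->
  \forall e \near (0 : R)^', `|a| / 2 <= `|a + e * f e|.
Proof.
move=> a0 [K fK]; have K1 : 0 < `|K| + 1 by rewrite ltr_wpDl.
have d0 : 0 < `|a| / 2 / (`|K| + 1) by rewrite !divr_gt0// normr_gt0.
near=> e.
have h1 : `|f e| <= `|K| + 1.
  rewrite (le_trans (_ : _ <= K))//; first by near: e.
  by rewrite (le_trans (ler_norm _))// lerDl.
have h2 : `|e| < `|a| / 2 / (`|K| + 1) by near: e; exact: dnbhs0_lt.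
have h3 : `|e * f e| <= `|a| / 2.
  rewrite normrM (le_trans (ler_pM _ _ (ltW h2) h1))// divfK// gt_eqF//.
have := lerB_dist a (- (e * f e)); rewrite opprK normrN.
lra.
Unshelve. all: by end_near. Qed.

Lemma bounded_near0_neq0 a f : a != 0 -> bounded_near0 f ->
  \forall e \near (0 : R)^', a + e * f e != 0.
Proof.
move=> a0 /(bounded_near0_perturb a0); apply: filterS => e he.
by rewrite -normr_gt0 (lt_le_trans _ he)// divr_gt0// normr_gt0.
Qed.

Lemma bounded_near0V a f : a != 0 -> bounded_near0 f ->
  bounded_near0 (fun e => (a + e * f e)^-1).
Proof.
move=> a0 hf; exists (`|a| / 2)^-1.
have := bounded_near0_perturb a0 hf; apply: filterS => e he.
by rewrite normfV lef_pV2// posrE ?(lt_le_trans _ he) ?divr_gt0 ?normr_gt0.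
Qed.

Lemma eq_bounded_near0 (f g : R -> R) :
  (\forall e \near (0 : R)^', f e = g e) -> bounded_near0 f -> bounded_near0 g.
Proof.
move=> fg [K fK]; exists K; near=> e.
by rewrite -(near fg e)//; near: e.
Unshelve. all: by end_near. Qed.

(** By the mean value theorem the increment of [f] is [e] times the derivative at some [c] between
    [t] and [t + e], and differentiability of the derivative at [t] bounds its change by a constant
    times [|c - t|]. *)
Lemma bounded_near0_taylor (f : R -> R) t :
  (\forall s \near t, derivable f s 1) -> derivable (derive1 f) t 1 ->
  bounded_near0 (fun e => (f (t + e) - f t - e * derive1 f t) / e ^+ 2).
Proof.
move=> df /cvg_ex[/= l hl].
pose K := `|l| + 1; exists K.
(* The difference quotient of the derivative is eventually within 1 of its limit [l], whence the
   constant [|l| + 1]. *)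
have : \forall h \near (0:R)^', `|derive1 f (t + h) - derive1 f t| <= K * `|h|.
  near=> h.
  have h0 : h != 0 by near: h; exact: nbhs_dnbhs_neq.
  have : `|l - h^-1 *: (derive1 f (h *: 1 + t) - derive1 f t)| <= 1.
    by near: h; move/cvgrPdist_le : hl => /(_ 1 ltr01).
  rewrite /= [h *: _]mulr1 [h + t]addrC => hd.
  rewrite -ler_pdivrMr ?normr_gt0// -normfV -normrM mulrC.
  rewrite -[X in `|X|](subKr l) (le_trans (ler_normB _ _))// lerD//.
move=> [d /= d0 hd]; move: df => [d' /= d'0 hd'].
near=> e.
have e0 : e != 0 by near: e; exact: nbhs_dnbhs_neq.
have ed : `|e| < d by near: e; exact: dnbhs0_lt.
have ed' : `|e| < d' by near: e; exact: dnbhs0_lt.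
(* The mean value theorem wants ordered endpoints; this form covers both signs of [e]. *)
have key a b : a <= b -> (forall c, c \in `[a, b] -> `|c - t| <= `|e|) ->
    exists2 c, `|c - t| <= `|e| & f b - f a = derive1 f c * (b - a).
  move=> ab hab; have hD c : c \in `[a, b] -> derivable f c 1.
    by move=> cab; apply: hd'; rewrite /= distrC (le_lt_trans (hab _ cab)).
  have [|/=|c cab hc] := @MVT_segment R f (derive1 f) a b ab.
  - move=> x xab; rewrite derive1E; apply/derivableP/hD.
    by rewrite in_itv/= !ltW ?(itvP xab).
  - by apply: derivable_within_continuous => x xab; exact: hD.
  - by exists c => //; apply: hab.
have [c hc ->] : exists2 c, `|c - t| <= `|e| & f (t + e) - f t = derive1 f c * e.
  have [e1|e1] := lerP 0 e.
    have [||c hc h] := key t (t + e); first by rewrite lerDl.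
      by move=> c /itvP cI; rewrite !ger0_norm// ?subr_ge0 ?cI// lerBlDl cI.
    by exists c => //; rewrite h addrAC subrr add0r.
  have [||c hc h] := key (t + e) t; first by rewrite gerDl ltW.
    move=> c /itvP cI; rewrite [`|e|]ltr0_norm// ler0_norm ?subr_le0 ?cI//.
    by rewrite opprB lerBlDl -lerBlDr opprK cI.
  by exists c => //; rewrite -opprB h; ring.
have -> : (derive1 f c * e - e * derive1 f t) / e ^+ 2 =
    (derive1 f (t + (c - t)) - derive1 f t) / e.
  by rewrite addrCA subrr addr0; field.
rewrite normrM normfV ler_pdivrMr ?normr_gt0//.
(* The bound [hd] holds on a punctured neighbourhood only, so [c = t] is treated apart. *)
have [->|ct] := eqVneq c t.
  by rewrite subrr addr0 subrr normr0 mulr_ge0// /K addr_ge0.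
rewrite (le_trans (hd (c - t) _ _))//= ?subr_eq0//.
  by rewrite sub0r normrN (le_lt_trans hc).
by rewrite ler_wpM2l// /K addr_ge0.
Unshelve. all: by end_near. Qed.

Definition remainder2 m n (x : R -> 'M[R]_(m.+1, n.+1)) (t e : R) :=
  (e ^+ 2)^-1 *: (x (t + e) - x t - e *: derive1 x t).

Lemma remainder2E m n (x : R -> 'M[R]_(m.+1, n.+1)) t e : e != 0 ->
  x (t + e) = x t + e *: derive1 x t + e ^+ 2 *: remainder2 x t e.
Proof.
move=> e0; rewrite /remainder2 scalerA divff ?expf_neq0// scale1r.
by rewrite -addrA [_ + (_ - _)]addrC subrK addrC subrK.
Qed.

Lemma remainder2_bounded m n (U : set R) (x : R -> 'M[R]_(m.+1, n.+1)) t i j :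
  open U -> smooth_on U x -> U t ->
  bounded_near0 (fun e => remainder2 x t e i j).
Proof.
move=> oU sx Ut; pose f s := x s i j.
have df s : U s -> derivable f s 1.
  move=> Us; have := sx 0%N s Us; rewrite derive1n0 => h; exact: ((derivable_mxP x s 1).1 h i j).
have xf s : U s -> derive1 x s i j = derive1 f s.
  by move=> Us; rewrite !derive1E derive_mx ?mxE//; exact: (sx 0%N).
have nU : \forall s \near t, U s by exact: open_nbhs_nbhs.
(* The derivative of an entry is known to be the entry of the derivative on [U], which suffices
   since [U] is a neighbourhood of [t]. *)
have : derivable (derive1 f) t 1.
  have : derivable (fun s => derive1 x s i j) t 1.
    by move: i j {df xf f}; apply/derivable_mxP; exact: (sx 1%N).
  apply: near_eq_derivable.
  by near=> s; rewrite xf//; near: s.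
move=> /bounded_near0_taylor -/(_ (filterS df nU)).
apply: eq_bounded_near0; near=> e.
by rewrite /remainder2 !mxE xf// mulrC.
Unshelve. all: by end_near. Qed.

(** Here [a], [b], [c], [d] stand for the pairings of the lifts and their derivatives, and the Greek
    functions for pairings that involve a remainder. At order two [al] and [be] occur alike in the
    numerator and in the expanded denominator, so they cancel and only [a * d - b * c] survives. *)
Lemma bounded_near0_cross_ratio (a b c d : R) (al be ga de : R -> R) : a != 0 ->
  bounded_near0 al -> bounded_near0 be -> bounded_near0 ga -> bounded_near0 de ->
  bounded_near0 (fun e =>
    (a * (a + e * b + e * c + e ^+ 2 * (d + al e + be e) + e ^+ 3 * ga e
          + e ^+ 4 * de e)
     / ((a + e * b + e ^+ 2 * al e) * (a + e * c + e ^+ 2 * be e))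
     - (1 + e ^+ 2 * ((a * d - b * c) / a ^+ 2))) / e ^+ 3).
Proof.
move=> a0 hal hbe hga hde.
(* The denominator is the product of a + e C1 and a + e C2, and the quotient is
   (B - C) over it. *)
pose C1 e := b + e * al e; pose C2 e := c + e * be e.
pose B e := a * ga e + - (b * be e + c * al e) + e * (a * de e + - (al e * be e)).
pose C e := (a * d - b * c) / a ^+ 2 * (a * C1 e + a * C2 e + e * (C1 e * C2 e)).
have hC1 : bounded_near0 C1.
  by do ?[exact: bounded_near0_cst|exact: bounded_near0_id|apply: bounded_near0D|apply: bounded_near0M].
have hC2 : bounded_near0 C2.
  by do ?[exact: bounded_near0_cst|exact: bounded_near0_id|apply: bounded_near0D|apply: bounded_near0M].
have : bounded_near0 (fun e => (B e + - C e) * (a + e * C1 e)^-1 * (a + e * C2 e)^-1).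
  by do ?[exact: bounded_near0_cst|exact: bounded_near0_id|apply: bounded_near0D|apply: bounded_near0N|exact: bounded_near0V|apply: bounded_near0M|assumption].
apply: eq_bounded_near0; near=> e.
have e0 : e != 0 by near: e; exact: nbhs_dnbhs_neq.
have n1 : a + e * C1 e != 0 by near: e; exact: bounded_near0_neq0.
have n2 : a + e * C2 e != 0 by near: e; exact: bounded_near0_neq0.
rewrite (_ : a + e * b + e ^+ 2 * al e = a + e * C1 e); last by rewrite /C1; ring.
rewrite (_ : a + e * c + e ^+ 2 * be e = a + e * C2 e); last by rewrite /C2; ring.
have {}n1 : a + e * (b + e * al e) != 0 by [].
have {}n2 : a + e * (c + e * be e) != 0 by [].
by rewrite /B /C /C1 /C2; field; rewrite ?e0 ?a0 ?n1 ?n2.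
Unshelve. all: by end_near. Qed.

Lemma eqaddO_bounded_near0 (f g : R -> R) (n : nat) :
  bounded_near0 (fun e => (f e - g e) / e ^+ n) ->
  (f : R -> R^o) = (g : R -> R^o) +O_ ((0 : R)^') (fun e => e ^+ n : R^o).
Proof.
move=> [K hK]; apply/eqaddOP/bigO_exP; exists (`|K| + 1); first by rewrite ltr_wpDl.
near=> e; have e0 : e != 0 by near: e; exact: nbhs_dnbhs_neq.
have : `|(f e - g e) / e ^+ n| <= K by near: e.
rewrite normrM normfV ler_pdivrMr ?normr_gt0 ?expf_neq0// => h.
rewrite (le_trans h)// ler_wpM2r// (le_trans (ler_norm _))// lerDl.
Unshelve. all: by end_near. Qed.

End BoundedNearZero.

(** * Velocities of projective curves through lifts *)

Section Velocity.
Context {R : realType} {m n : nat}.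
Set Implicit Arguments.
Unset Strict Implicit.
Unset Printing Implicit Defensive.
Local Notation V := 'M[R]_(m.+1, n.+1).

(** A smooth curve makes the set in [velocity] inhabited. The lift obtained is the one behind the
    value picked by [xget], which may differ from the lift supplied by [smooth_curve]. *)
Lemma velocity_lift (D : set R) (L : R -> {vspace V}) t :
  smooth_curve D L -> D t -> exists U x,
  [/\ U t, smooth_lift U L x & velocity L t = dproj (x t) (derive1 x t)].
Proof.
move=> sL /sL[U [x [Ut hx]]]; rewrite /velocity.
set S := [set w | _].
have Sx : S (dproj (x t) (derive1 x t)) by exists U, x.
exact: xgetI Sx.
Qed.

Lemma zero_tangent_line (x : V) : x != 0 -> zero_tangent <[x]> = dproj x 0.
Proof.
move=> /vpick_line[k k0 e]; rewrite /zero_tangent e.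
by rewrite -[RHS](dproj_eq _ _ 0 k0) scaler0 scale0r addr0.
Qed.

(** Radial vectors are killed by the differential of the projection; this turns non-degeneracy into
    independence of a lift and its derivative. *)
Lemma dproj_colinear (x : V) k : dproj x (k *: x) = dproj x 0.
Proof. by rewrite -[RHS](dproj_eq _ _ k (oner_neq0 R)) scaler0 add0r scale1r. Qed.

End Velocity.

(** * Expansion of the cross-ratio along the curve *)

Theorem proposition5p5 (R : realType)
    (g : set ('cV[R]_3 * 'cV[R]_3) * set ('rV[R]_3 * 'rV[R]_3) ->
         set ('cV[R]_3 * 'cV[R]_3) * set ('rV[R]_3 * 'rV[R]_3) -> R)
    (D : set R) (Gamma : R -> {vspace 'cV[R]_3} * {vspace 'rV[R]_3}) :
  dancing_metric g ->
  open D -> is_interval D ->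
  smooth_curve_M4 D Gamma -> nondegenerate_curve D Gamma ->
  forall t : R, D t ->
  let v := velocity_M4 Gamma t in
  let q (s : R) := (Gamma s).1 in
  let p (s : R) := line_points (Gamma s).2 in
  let l (e : R) := (q t + q (t + e)%R)%VS in
  let qbar (e : R) := (l e :&: p t)%VS in
  let qbar_ (e : R) := (l e :&: p (t + e)%R)%VS in
  ((fun e : R => cross_ratio (q t) (qbar e) (q (t + e)) (qbar_ e) : R^o) =
    (fun e : R => 2^-1 * e ^+ 2 * g v v : R^o)
      +O_ ((0 : R)^') (fun e : R => e ^+ 3 : R^o)) /\
  ((fun e : R => cross_ratio (q t) (q (t + e)) (qbar e) (qbar_ e) : R^o) =
    (fun e : R => 1 - 2^-1 * e ^+ 2 * g v v : R^o)
      +O_ ((0 : R)^') (fun e : R => e ^+ 3 : R^o)).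
Proof.
move=> hg oD _ [GM sq sp] nd t Dt v q p l qbar qbar_.
have [U [x [Ut [oU sx hx] vx]]] := velocity_lift sq Dt.
have [U' [y [Ut' [oU' sy hy] vy]]] := velocity_lift sp Dt.
have [x0 ex] := hx t Ut; have [y0 ey] := hy t Ut'.
have yx : pairing (y t) (x t) != 0.
  have [q' [p' [h eq ep]]] := GM t Dt.
  have /vlineP[k ek] : q' \in <[x t]>%VS by rewrite -ex eq memv_line.
  have /vlineP[k' ek'] : p' \in <[y t]>%VS by rewrite -ey ep memv_line.
  by apply: contraNneq h => h; rewrite ek ek' !pairE h !mulr0.
have nx k : derive1 x t <> k *: x t.
  move=> e; have [] := nd t Dt; rewrite /velocity_M4 /= vx ex e.
  by rewrite zero_tangent_line// dproj_colinear.
set x1 := derive1 x t in vx nx; set y1 := derive1 y t in vy.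
(* This form will certify that [x (t + e)] leaves the line spanned by [x t]. *)
have [h hx0 hx1] := exists_annihilator yx nx.
(* On the diagonal the two symmetric halves of [dancing_formula] coincide, whence the factor 2. *)
have gv : g v v = - 2 * ((pairing (y t) (x t) * pairing y1 x1 -
    pairing (y t) x1 * pairing y1 (x t)) / pairing (y t) (x t) ^+ 2).
  have -> : v = dpi (x t, y t) (x1, y1) by rewrite /v /velocity_M4 vx vy.
  by rewrite (dancing_metricE hg)// /dancing_formula /=; field.
pose r e := remainder2 x t e; pose u e := remainder2 y t e.
have rb i j : bounded_near0 (fun e => r e i j) by exact: remainder2_bounded oU sx Ut.
have ub i j : bounded_near0 (fun e => u e i j) by exact: remainder2_bounded oU' sy Ut'.
have pr p' : bounded_near0 (fun e => pairing p' (r e)).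
  by apply: bounded_near0_pairing => // j; exact: bounded_near0_cst.
have ur q' : bounded_near0 (fun e => pairing (u e) q').
  by apply: bounded_near0_pairing => // j; exact: bounded_near0_cst.
have prur : bounded_near0 (fun e => pairing (u e) (r e)) by exact: bounded_near0_pairing.
have xE e : e != 0 -> x (t + e) = x t + e *: x1 + e ^+ 2 *: r e by exact: remainder2E.
have yE e : e != 0 -> y (t + e) = y t + e *: y1 + e ^+ 2 *: u e by exact: remainder2E.
clearbody r u x1 y1.
have eP : \forall e \near (0 : R)^',
  cross_ratio (q t) (qbar e) (q (t + e)) (qbar_ e) =
    1 - cross_ratio (q t) (q (t + e)) (qbar e) (qbar_ e) /\
  cross_ratio (q t) (q (t + e)) (qbar e) (qbar_ e) =
  pairing (y t) (x t) *
  (pairing (y t) (x t) + e * pairing (y t) x1 + e * pairing y1 (x t)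
   + e ^+ 2 * (pairing y1 x1 + pairing (y t) (r e) + pairing (u e) (x t))
   + e ^+ 3 * (pairing y1 (r e) + pairing (u e) x1)
   + e ^+ 4 * pairing (u e) (r e))
  / ((pairing (y t) (x t) + e * pairing (y t) x1 + e ^+ 2 * pairing (y t) (r e)) *
     (pairing (y t) (x t) + e * pairing y1 (x t) + e ^+ 2 * pairing (u e) (x t))).
  near=> e.
  have e0 : e != 0 by near: e; exact: nbhs_dnbhs_neq.
  have Ue : U (t + e) by near: e; exact: near0_shift.
  have Ue' : U' (t + e) by near: e; exact: near0_shift.
  have [xe0 exe] := hx _ Ue; have [ye0 eye] := hy _ Ue'.
  have n1 : pairing (y t) (x (t + e)) != 0.
    have -> : pairing (y t) (x (t + e)) = pairing (y t) (x t) +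
      e * (pairing (y t) x1 + e * pairing (y t) (r e)).
      by rewrite xE// !pairE; ring.
    near: e; apply: bounded_near0_neq0 => //.
    apply: bounded_near0D; first exact: bounded_near0_cst.
    by apply: bounded_near0M => //; exact: bounded_near0_id.
  have n2 : pairing (y (t + e)) (x t) != 0.
    have -> : pairing (y (t + e)) (x t) = pairing (y t) (x t) +
      e * (pairing y1 (x t) + e * pairing (u e) (x t)).
      by rewrite yE// !pairE; ring.
    near: e; apply: bounded_near0_neq0 => //.
    apply: bounded_near0D; first exact: bounded_near0_cst.
    by apply: bounded_near0M => //; exact: bounded_near0_id.
  (* Since [h] kills [x t], its value at [x (t + e)] is [e] times a perturbation of [pairing h x1],
     hence nonzero for small nonzero [e]. *)
  have ind k : x (t + e) <> k *: x t.
    move=> /(congr1 (pairing h)); rewrite xE// !pairE hx0 mulr0 add0r.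
    rewrite (_ : _ + _ = e * (pairing h x1 + e * pairing h (r e))); last by ring.
    apply/eqP; rewrite mulf_neq0//; near: e; exact: bounded_near0_neq0.
  rewrite /q /qbar /qbar_ /l /p /q ex ey exe eye.
  have [-> ->] := cross_ratio_chord yx n1 n2 ind.
  split=> //; rewrite xE// yE// !pairE; congr (_ * _ / (_ * _)); ring.
have := @bounded_near0_cross_ratio R _ (pairing (y t) x1) (pairing y1 (x t))
  (pairing y1 x1) _ _ _ _ yx (pr (y t)) (ur (x t))
  (bounded_near0D (pr y1) (ur x1)) prur.
set F := (fun e => _) => hF.
(* By [gv], the quadratic term in [F] is minus half of [e ^+ 2 * g v v]. The first cross-ratio is 1
   minus the second, so its error quotient is the opposite of [F]. *)
split; apply: eqaddO_bounded_near0.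
- apply: eq_bounded_near0 (bounded_near0N hF).
  move: eP; apply: filterS => e [-> ->].
  rewrite -[LHS]mulNr gv; congr (_ * _); move: (_ * _ / (_ * _)) => P.
  by field.
- apply: eq_bounded_near0 hF; move: eP; apply: filterS => e [_ ->].
  rewrite /F gv; congr (_ * _); move: (_ * _ / (_ * _)) => P.
  by field.
Unshelve. all: by end_near. Qed.
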